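(* Let $(X_n,Y_n)$ be the random walk on the hexagonal lattice started at the origin. The sequence $\left\{\left(\frac{X_n}{n},\frac{Y_n}{n}\right):n\ge1\right\}$ satisfies the large deviation principle on $\mathbb R^2$ with speed $v_n=n$ and good rate function $$\Lambda^*(x,y)=\sup_{(\lambda_1,\lambda_2)\in\mathbb R^2}\{\lambda_1x+\lambda_2y-\Lambda(\lambda_1,\lambda_2)\},$$ where $$\Lambda(\lambda_1,\lambda_2)=\frac12\log\left(g_0(\lambda_1,\lambda_2)\,g_1(\lambda_1,\lambda_2)\right)$$ and, for $i=0,1$, $$g_i(\lambda_1,\lambda_2)=q_{i,0}+q_{i,1}e^{(-1)^i\sqrt3a\left(-\frac{\sqrt3}{2}\lambda_1+\frac12\lambda_2\right)}+q_{i,2}e^{(-1)^{i+1}\sqrt3a\left(\frac{\sqrt3}{2}\lambda_1+\frac12\lambda_2\right)}.$$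
   Context: Fix $a>0$ and nonnegative numbers $q_{i,r}$ ($i=0,1$; $r=0,1,2$) with $\sum_{r=0}^2 q_{i,r}=1$ for $i=0,1$. The vertices of the hexagonal lattice are $\mathscr V_0\cup\mathscr V_1$, where $$\mathscr V_i=\left\{\left(\tfrac32 aj+ia,\ \tfrac{\sqrt3}{2}aj+\sqrt3 ak\right): j,k\in\mathbb Z\right\},\quad i=0,1.$$ $\{(X_n,Y_n):n\in\mathbb N_0\}$ is the time-homogeneous Markov chain on $\mathscr V_0\cup\mathscr V_1$ which, from a vertex $(x,y)\in\mathscr V_i$, moves in one step to $\left(x+a\cos(\tfrac{2\pi r}{3}+i\pi),\ y+a\sin(\tfrac{2\pi r}{3}+i\pi)\right)$ with probability $q_{i,r}$, $r=0,1,2$ (such a point belongs to $\mathscr V_{1-i}$). The initial condition is $(X_0,Y_0)=(0,0)$ almost surely. A speed is a sequence of positive numbers $v_n\to\infty$. A rate function on a topological space $\mathcal Z$ is a lower semicontinuous $I:\mathcal Z\to[0,\infty]$; it is good if all level sets $\{z:I(z)\le\eta\}$, $\eta\ge0$, are compact. A sequence of $\mathcal Z$-valued random variables $\{Z_n\}$ satisfies the large deviation principle with speed $v_n$ and rate function $I$ if $\liminf_{n\to\infty}\frac1{v_n}\log P(Z_n\in O)\ge-\inf_{z\in O}I(z)$ for all open $O$ and $\limsup_{n\to\infty}\frac1{v_n}\log P(Z_n\in K)\le-\inf_{z\in K}I(z)$ for all closed $K$. *)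

(* Defs.v *)
From HB Require Import structures.
From mathcomp Require Import all_boot all_order all_algebra.
From mathcomp Require Import all_classical all_reals all_analysis.

Set Implicit Arguments.
Unset Strict Implicit.
Unset Printing Implicit Defensive.

Import Order.TTheory GRing.Theory Num.Theory.
Import numFieldNormedType.Exports.

Local Open Scope classical_set_scope.
Local Open Scope ring_scope.

(** * Large deviations *)

Definition rate_function (R : realType) (Z : topologicalType)
    (I : Z -> \bar R) : Prop :=
  (forall z, (0 <= I z)%E) /\ lower_semicontinuous I.

Definition good_rate_function (R : realType) (Z : topologicalType)
    (I : Z -> \bar R) : Prop :=
  rate_function I /\
  forall eta : R, 0 <= eta -> compact [set z | (I z <= eta%:E)%E].

Definition speed (R : realType) (v : nat -> R) : Prop :=
  (forall n, 0 < v n) /\ v n @[n --> \oo] --> +oo.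

(* The second conjunct says that each [Zn n] is a random variable, i.e.
   measurable for the Borel sets of [Z]. [lne] is the extended logarithm, with
   [lne 0 = -oo]; the infimum over the empty set is [+oo]. *)
Definition satisfies_LDP (d : measure_display) (T : measurableType d)
    (R : realType) (P : probability T R) (Z : topologicalType)
    (Zn : nat -> T -> Z) (v : nat -> R) (I : Z -> \bar R) : Prop :=
  [/\ speed v,
      (forall n (O : set Z), open O -> measurable (Zn n @^-1` O)),
      rate_function I,
      (forall O : set Z, open O ->
         (- ereal_inf [set I z | z in O] <=
          limn_einf (fun n => ((v n)^-1)%:E * lne (P (Zn n @^-1` O))))%E)
    & (forall K : set Z, closed K ->
         (limn_esup (fun n => ((v n)^-1)%:E * lne (P (Zn n @^-1` K))) <=
          - ereal_inf [set I z | z in K])%E)].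

(** * Markov chains *)

Definition cond_prob (d : measure_display) (T : measurableType d)
    (R : realType) (P : probability T R) (A B : set T) : R :=
  fine (P (A `&` B)) / fine (P B).

Definition markov_chain (d : measure_display) (T : measurableType d)
    (R : realType) (P : probability T R) (U : Type) (S : set U)
    (p : U -> U -> R) (Z : nat -> T -> U) : Prop :=
  (forall n t, S (Z n t)) /\
  forall (n : nat) (z : nat -> U),
    (forall k, (k <= n.+1)%N -> S (z k)) ->
    let past := [set t | forall k, (k <= n)%N -> Z k t = z k] in
    P past != 0%E ->
    cond_prob P [set t | Z n.+1 t = z n.+1] past = p (z n) (z n.+1).

(** * The random walk on the hexagonal lattice *)

Section Hexagonal.
Variables (R : realType) (a : R) (q : 'I_2 -> 'I_3 -> R).

Definition hex_vertices (i : 'I_2) : set (R * R) :=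
  [set z | exists j k : int,
     z = (3 / 2 * a * j%:~R + i%:R * a,
          Num.sqrt 3 / 2 * a * j%:~R + Num.sqrt 3 * a * k%:~R)].

Definition hex_lattice : set (R * R) :=
  hex_vertices 0 `|` hex_vertices 1.

Definition hex_move (i : 'I_2) (r : 'I_3) (z : R * R) : R * R :=
  (z.1 + a * cos (2 * pi * r%:R / 3 + i%:R * pi),
   z.2 + a * sin (2 * pi * r%:R / 3 + i%:R * pi)).

Definition hex_transition (z w : R * R) : R :=
  \sum_(i < 2 | z \in hex_vertices i) \sum_(r < 3 | w == hex_move i r z) q i r.

Definition hex_g (i : 'I_2) (l : R * R) : R :=
  q i 0
  + q i 1 * expR ((-1) ^+ i * Num.sqrt 3 * a
                  * (- (Num.sqrt 3 / 2) * l.1 + 1 / 2 * l.2))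
  + q i 2 * expR ((-1) ^+ i.+1 * Num.sqrt 3 * a
                  * (Num.sqrt 3 / 2 * l.1 + 1 / 2 * l.2)).

Definition hex_Lambda (l : R * R) : R := 1 / 2 * ln (hex_g 0 l * hex_g 1 l).

Definition hex_Lambda_star (z : R * R) : \bar R :=
  ereal_sup [set (l.1 * z.1 + l.2 * z.2 - hex_Lambda l)%:E
            | l in [set: R * R]].

End Hexagonal.

(* Main.v *)
(* The walk alternates between the two halves of the lattice, so its n-step
   moment generating function is exactly a product of one-step ones, hence
   equals e^(n Lambda) up to a factor depending on the tilt but not on n.  This
   suffices for a bare-hands Gartner-Ellis argument.
   Upper bound: after restriction to a compact box, a closed set on which
   Lambda* > c is covered by finitely many half-spaces {l.x - Lambda(l) > c},
   each of which is handled by Chernoff's inequality.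
   Lower bound: maximising l.x - Lambda(l) - eps |l|^2 / 2, which is always
   attained, yields l such that y = x - eps l is the slope of Lambda at l, is
   close to x, and satisfies l.y - Lambda(l) <= Lambda*(x); tilting by l
   concentrates the walk near y, again by Chernoff's inequality. *)

Require Import Defs.
From HB Require Import structures.
From mathcomp Require Import all_boot all_order all_algebra.
From mathcomp Require Import ring lra zify.
From mathcomp Require Import all_classical all_reals all_analysis.

Set Implicit Arguments.
Unset Strict Implicit.
Unset Printing Implicit Defensive.

Import Order.TTheory GRing.Theory Num.Theory.
Import numFieldNormedType.Exports.

Local Open Scope classical_set_scope.
Local Open Scope ring_scope.

(** * Legendre transforms and limits of extended reals *)

Definition dot (R : realType) (l z : R * R) : R := l.1 * z.1 + l.2 * z.2.

Definition legendre (R : realType) (Lam : R * R -> R) (z : R * R) : \bar R :=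
  ereal_sup [set (dot l z - Lam l)%:E | l in [set: R * R]].

Lemma dot_continuous (R : realType) (l : R * R) : continuous (dot l).
Proof.
move=> z; apply: cvgD; apply: cvgM; try exact: cvg_cst.
  exact: cvg_fst.
exact: cvg_snd.
Qed.

Lemma legendre_le (R : realType) (Lam : R * R -> R) (z : R * R) (b : R) :
  (legendre Lam z <= b%:E)%E <-> forall l, dot l z - Lam l <= b.
Proof.
split=> [Lb l|Lb]; last by apply: ge_ereal_sup => _ [l _ <-]; rewrite lee_fin.
by rewrite -lee_fin; apply: le_trans Lb; apply: ereal_sup_ubound; exists l.
Qed.

Lemma open_halfspace (R : realType) (l : R * R) (b c : R) :
  open [set z | c < dot l z - b].
Proof.
have -> : [set z | c < dot l z - b] = dot l @^-1` [set t | c + b < t].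
  by apply/seteqP; split=> z /=; rewrite ltrBrDr.
by apply: open_comp; [move=> z _; exact: dot_continuous|exact: open_gt].
Qed.

Lemma legendre_gt (R : realType) (Lam : R * R -> R) (z : R * R) (c : R) :
  (c%:E < legendre Lam z)%E <-> exists l, c < dot l z - Lam l.
Proof.
split=> [cL|[l cl]].
  apply: contrapT => /forallNP nl; move: cL; apply/negP; rewrite -leNgt.
  by apply/legendre_le => l; rewrite leNgt; apply/negP.
apply: (@lt_le_trans _ _ (dot l z - Lam l)%:E); first by rewrite lte_fin.
by apply: ereal_sup_ubound; exists l.
Qed.

(** Each strict superlevel set is a union of open half-spaces, one for each [l]. *)
Lemma legendre_lsc (R : realType) (Lam : R * R -> R) :
  lower_semicontinuous (legendre Lam).
Proof.
apply/lower_semicontinuousP => c.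
have -> : [set z | (c%:E < legendre Lam z)%E] =
    \bigcup_l [set z | c < dot l z - Lam l].
  apply/seteqP; split=> z /=; first by move/legendre_gt => [l cl]; exists l.
  by move=> [l _ cl]; apply/legendre_gt; exists l.
by apply: bigcup_open => l _; exact: open_halfspace.
Qed.

Definition box (R : realType) (B : R) : set (R * R) :=
  `[- B, B]%classic `*` `[- B, B]%classic.

Lemma box_compact (R : realType) (B : R) : compact (box B).
Proof. by apply: compact_setX; exact: segment_compact. Qed.

Lemma box_scale (R : realType) (N B : R) (z : R * R) :
  0 < N -> box (N * B) z -> box B (z.1 / N, z.2 / N).
Proof.
move=> N0 []; rewrite /= !in_itv /= => /andP[? ?] /andP[? ?].
by split; rewrite /= in_itv /= ler_pdivlMr// ler_pdivrMr// mulNr [B * _]mulrC;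
  apply/andP; split.
Qed.

(** Nonnegativity comes from testing [l = 0]. Testing [l] at plus or minus each unit vector confines
    a level set to a box, where closedness gives compactness. *)
Lemma legendre_good (R : realType) (Lam : R * R -> R) :
  Lam 0 = 0 -> good_rate_function (legendre Lam).
Proof.
move=> Lam0; split.
  split; last exact: legendre_lsc.
  move=> z; apply: ereal_sup_ubound; exists 0 => //.
  by rewrite Lam0 /dot /= !mul0r addr0 subr0.
move=> b b0.
set e1 : R * R := (1, 0); set e2 : R * R := (0, 1).
set B := b + `|Lam e1| + `|Lam (- e1)| + `|Lam e2| + `|Lam (- e2)|.
apply: (@subclosed_compact _ _ (box B)); last 2 first.
- exact: box_compact.
- move=> z /= /legendre_le zb.
  have := (normr_ge0 (Lam e1), normr_ge0 (Lam (- e1)),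
           normr_ge0 (Lam e2), normr_ge0 (Lam (- e2))) => -[[[]]] n1 n2 n3 n4.
  have := (zb e1, zb (- e1), zb e2, zb (- e2)) => -[[[]]].
  rewrite /dot /= !oppr0 !mul0r !addr0 !add0r !mul1r !mulN1r.
  have := (ler_norm (Lam e1), ler_norm (Lam (- e1)),
           ler_norm (Lam e2), ler_norm (Lam (- e2))) => -[[[]]] m1 m2 m3 m4.
  move=> h1 h2 h3 h4.
  by split; rewrite /= in_itv /= /B; apply/andP; split; lra.
- have -> : [set z | (legendre Lam z <= b%:E)%E] =
      ~` [set z | (b%:E < legendre Lam z)%E].
    apply/seteqP; split=> z /=; first by rewrite leNgt => /negP.
    by move/negP; rewrite -leNgt.
  apply: open_closedC.
  by move/lower_semicontinuousP : (@legendre_lsc _ Lam).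
Qed.

(** * Comparisons of extended reals and of their limits *)

Lemma limn_esup_le_near (R : realType) (u : nat -> \bar R) (c : \bar R) :
  (\forall n \near \oo, (u n <= c)%E) -> (limn_esup u <= c)%E.
Proof.
move=> uc; apply: (@le_trans _ _ (ereal_sup (u @` [set n | (u n <= c)%E]))).
  by apply: ereal_inf_lbound; exists [set n | (u n <= c)%E].
by apply: ge_ereal_sup => _ [n /= un <-].
Qed.

Lemma limn_einf_ge_near (R : realType) (u : nat -> \bar R) (c : \bar R) :
  (\forall n \near \oo, (c <= u n)%E) -> (c <= limn_einf u)%E.
Proof.
move=> cu; rewrite /limn_einf leeNr; apply: limn_esup_le_near.
by apply: filterS cu => n cun; rewrite leeN2.
Qed.

(** Reduces both large deviation bounds to a real level [r], so that infinite infima need no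
    separate treatment. *)
Lemma lee_fin_lt (R : realType) (x y : \bar R) :
  (forall r : R, (r%:E < x)%E -> (r%:E <= y)%E) -> (x <= y)%E.
Proof.
move=> h; rewrite leNgt; apply/negP => yx.
case: x y h yx => [x| |] [y| |] //= h.
- rewrite lte_fin => yx.
  have := h ((x + y) / 2); rewrite lte_fin lee_fin => /(_ ltac:(lra)); lra.
- by move=> _; have := h (x - 1); rewrite lte_fin => /(_ ltac:(lra)).
- move=> _; have := h (y + 1); rewrite ltry lee_fin => /(_ isT); lra.
- by move=> _; have := h 0; rewrite ltry => /(_ isT).
Qed.

(** * The Gartner-Ellis bounds for finitely supported laws *)

(** Indices rather than points carry the weights, so that several paths may share an endpoint. *)
Definition weighted_prob (R : realType) (I : finType) (w : I -> R)
    (z : I -> R * R) (A : set (R * R)) : R :=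
  \sum_(i | `[< A (z i) >]) w i.

(** Decay of order [1 / x] is all that the tilting argument takes from the exponential. *)
Lemma expRN_le_inv (R : realType) (x : R) : 0 < x -> expR (- x) <= x^-1.
Proof.
move=> x0; rewrite expRN lef_pV2 ?posrE ?expR_gt0//.
by apply: le_trans (expR_ge1Dx x); rewrite lerDr.
Qed.

(** The derivative vanishes at the minimum 0, so the difference quotients there fall below any
    [del]. *)
Lemma slope_at_min (R : realType) (psi : R -> R) (del : R) :
  (forall s, derivable psi s 1) -> psi 0 = 0 -> (forall s, 0 <= psi s) ->
  0 < del -> exists2 s, 0 < s & psi s < s * del.
Proof.
move=> dpsi psi0 psi_ge0 del0.
have [dp v0] : is_derive (0 : R) (1 : R) psi (0 : R).
  apply: (@derive1_at_min _ psi (-1) 1) => [|t _||t _].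
  - by lra.
  - exact: dpsi.
  - by rewrite in_itv /=; apply/andP; split; lra.
  - by rewrite psi0.
have /cvgrPdist_lt /(_ _ del0) :
    (fun h : R => h^-1 *: (psi (h *: (1 : R) + 0) - psi 0)) @ 0^' -->
    'D_(1 : R) psi (0 : R) by exact: dp.
rewrite v0.
move=> [e /= e0 He].
exists (e / 2); first lra.
have := He (e / 2); rewrite /ball_ /= !sub0r normrN gtr0_norm ?divr_gt0//.
move=> /(_ ltac:(lra)) /(_ ltac:(lra)).
rewrite psi0 subr0 addr0 normrN [_ *: 1]mulr1 => h.
have e2 : 0 < e / 2 by lra.
rewrite -ltr_pdivrMl//; apply: le_lt_trans h; exact: ler_norm.
Qed.

Section GartnerEllis.
Variables (R : realType) (I : nat -> finType).
Variables (w : forall n, I n -> R) (z : forall n, I n -> R * R).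
Variables (Lam : R * R -> R) (C : R * R -> R) (B : R).
Hypothesis w_ge0 : forall n i, 0 <= w (n := n) i.
Hypothesis z_box : forall n i, box B (z (n := n) i).
Hypothesis C_gt0 : forall l, 0 < C l.
Hypothesis mgf_le : forall n l,
  \sum_i w i * expR (n.+1%:R * dot l (z (n := n) i)) <=
  C l * expR (n.+1%:R * Lam l).
Hypothesis mgf_ge : forall n l,
  (C l)^-1 * expR (n.+1%:R * Lam l) <=
  \sum_i w i * expR (n.+1%:R * dot l (z (n := n) i)).

Let prob n := weighted_prob (@w n) (@z n).

(** The prefactor is the sum of [C l] over the finite subcover; it is independent of [n], hence
    invisible on the exponential scale. *)
Lemma weighted_upper_bound (K : set (R * R)) (c : R) :
  closed K -> (forall x, K x -> (c%:E < legendre Lam x)%E) ->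
  exists D : R, forall n, prob n K <= D * expR (- (n.+1%:R * c)).
Proof.
move=> Kc cK.
have cKB : compact (K `&` box B).
  apply: (@subclosed_compact _ _ (box B)); [|exact: box_compact|by move=> x []].
  apply: closedI => //; apply: compact_closed (@box_compact R B).
  exact: norm_hausdorff.
(* The pointed topology required by [compact_cover] is not inferred on R * R. *)
have := cKB; rewrite (@compact_cover (HB.pack_for ptopologicalType (R * R)%type
  (isPointed.Build (R * R)%type 0))).
move=> /(_ _ setT (fun l => [set x | c < dot l x - Lam l])).
case=> [l _|x [Kx _]|D _ KD]; first exact: open_halfspace.
  by have /legendre_gt[l cl] := cK _ Kx; exists l.
exists (\sum_(l <- finmap.enum_fset D) C l) => n.
rewrite mulr_suml.
have N0 : 0 < n.+1%:R :> R by rewrite ltr0n.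
apply: (@le_trans _ _ (\sum_(l <- finmap.enum_fset D) \sum_i w (n := n) i *
    expR (n.+1%:R * (dot l (z i) - Lam l - c)))); last first.
  apply: ler_sum => l _.
  have := ler_wpM2r (expR_ge0 (- (n.+1%:R * (Lam l + c)))) (mgf_le n l).
  rewrite mulr_suml -mulrA -expRD.
  rewrite (_ : n.+1%:R * Lam l - _ = - (n.+1%:R * c)); last ring.
  apply: le_trans; apply: ler_sum => i _; rewrite -mulrA -expRD.
  by rewrite (_ : n.+1%:R * (_ - _ - _) =
    n.+1%:R * dot l (z i) - n.+1%:R * (Lam l + c)) //; ring.
rewrite exchange_big /= /prob /weighted_prob big_mkcond /=.
apply: ler_sum => i _; case: asboolP => Ki; last first.
  by apply: sumr_ge0 => l _; rewrite mulr_ge0 ?expR_ge0.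
(* An atom in [K] lies in some half-space of the subcover, and the exponential attached to that [l]
   is at least 1 there; the other terms are nonnegative. *)
have [l lD /= cl] := KD _ (conj Ki (z_box i)).
rewrite (big_rem l) //= -[leLHS]addr0 lerD//.
  rewrite ler_peMr// -expR0 ler_expR mulr_ge0 ?ltW//; lra.
by apply: sumr_ge0 => l' _; rewrite mulr_ge0 ?expR_ge0.
Qed.

(** The tilted mass totals at least [(C l)^-1 * expR (N * Lam l)]. Chernoff's inequality in the four
    axis directions leaves at most half of this outside the square around [y]; inside it the tilting
    factor is at most [expR (N * (dot l y + (|l.1| + |l.2|) * del))], and dividing by it recovers
    the untilted mass. *)
Lemma weighted_lower_bound_tilt (y l : R * R) (del : R) :
  0 < del ->
  (forall u : R * R, exists2 s, 0 < s &
    Lam (l.1 + s * u.1, l.2 + s * u.2) - Lam l - s * dot u y < s * del) ->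
  exists2 c : R, 0 < c & \forall n \near \oo,
    c * expR (n.+1%:R * (Lam l - dot l y - (`|l.1| + `|l.2|) * del)) <=
    prob n [set x | `|x.1 - y.1| < del /\ `|x.2 - y.2| < del].
Proof.
move=> del0 slope.
have [s hs] : {s : R * R -> R & forall u, 0 < s u /\
    Lam (l.1 + s u * u.1, l.2 + s u * u.2) - Lam l - s u * dot u y < s u * del}.
  by apply: (@choice _ _ (fun u s => 0 < s /\
    Lam (l.1 + s * u.1, l.2 + s * u.2) - Lam l - s * dot u y < s * del)) => u;
    have [s0 ? ?] := slope u; exists s0.
pose L u := (l.1 + s u * u.1, l.2 + s u * u.2).
(* [k u] is the Chernoff exponent of the tilted mass in the half-plane [dot u x >= dot u y + del];
   the choice of [s u] makes it positive. *)
pose k u := s u * (dot u y + del) - (Lam (L u) - Lam l).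
have k0 u : 0 < k u.
  by have [_] := hs u; rewrite -/(L u) /k; lra.
pose dirs : seq (R * R) := [:: (1, 0); (-1, 0); (0, 1); (0, -1)].
pose D := \sum_(u <- dirs) C (L u) / k u.
exists ((C l)^-1 / 2); first by rewrite divr_gt0// invr_gt0.
(* Beyond this threshold [D / n.+1] is below [(C l)^-1 / 2], the share of the lower bound in
   [mgf_ge] that the bad directions may consume. *)
have : \forall n \near \oo, 2 * C l * D < n.+1%:R.
  near=> n; apply: (@lt_trans _ _ n%:R); last by rewrite ltr_nat.
  near: n; exact: nbhs_infty_gtr.
apply: filterS => n nD.
have N0 : 0 < n.+1%:R :> R by rewrite ltr0n.
set A := [set x : R * R | _].
set N : R := n.+1%:R in nD N0 *.
pose bad u := \sum_i w (n := n) i *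
   expR (N * (dot l (z i) + s u * (dot u (z i) - dot u y - del))).
have bad_le u : bad u <= C (L u) / k u / N * expR (N * Lam l).
  apply: (@le_trans _ _ (C (L u) * expR (- (N * k u)) * expR (N * Lam l))).
    have := ler_wpM2r (expR_ge0 (- (N * (s u * (dot u y + del)))))
      (mgf_le n (L u)).
    rewrite mulr_suml -!mulrA -!expRD /k -/N.
    rewrite (_ : _ - _ * _ =
      - (N * (s u * (dot u y + del) - (Lam (L u) - Lam l))) + N * Lam l);
      last ring.
    apply: le_trans; apply: ler_sum => i _; rewrite -mulrA -expRD.
    rewrite (_ : N * dot (L u) _ + _ =
       N * (dot l (z i) + s u * (dot u (z i) - dot u y - del))) //.
    by rewrite /dot /L /=; ring.
  rewrite ler_pM2r ?expR_gt0// -!mulrA ler_pM2l// -invfM [_ * N]mulrC.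
  by apply: expRN_le_inv; rewrite mulr_gt0.
(* An atom outside [A] exceeds [y] by at least [del] in one of the four directions, and the
   corresponding term of [bad] then dominates its tilted weight. *)
have split_mgf : \sum_i w i * expR (N * dot l (z (n := n) i)) <=
    expR (N * (dot l y + (`|l.1| + `|l.2|) * del)) * prob n A
    + \sum_(u <- dirs) bad u.
  rewrite /bad exchange_big /= /prob /weighted_prob.
  rewrite [X in _ * X + _]big_mkcond /= mulr_sumr.
  rewrite -big_split /=; apply: ler_sum => i _.
  have pos u : 0 <= w i *
      expR (N * (dot l (z i) + s u * (dot u (z i) - dot u y - del))).
    by rewrite mulr_ge0// expR_ge0.
  case: asboolP => [[A1 A2]|nA].
    rewrite -[leLHS]addr0 lerD//; last by apply: sumr_ge0.
    rewrite mulrC ler_wpM2r// ler_expR ler_pM2l//.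
    rewrite -lerBlDl mulrDl /dot.
    rewrite (_ : _ - _ = l.1 * ((z i).1 - y.1) + l.2 * ((z i).2 - y.2));
      last ring.
    by apply: lerD; apply: le_trans (ler_norm _) _; rewrite normrM ler_wpM2l//;
      exact: ltW.
  rewrite mulr0 add0r.
  have key u : u \in dirs -> del <= dot u (z i) - dot u y ->
     w i * expR (N * dot l (z i)) <= \sum_(u <- dirs)
       w i * expR (N * (dot l (z i) + s u * (dot u (z i) - dot u y - del))).
    move=> ud h; rewrite (big_rem u) //= -[leLHS]addr0 lerD//;
      last exact: sumr_ge0.
    rewrite ler_wpM2l// ler_expR ler_pM2l// lerDl mulr_ge0//.
      by have [/ltW] := hs u.
    by rewrite subr_ge0.
  have {nA} : del <= `|(z i).1 - y.1| \/ del <= `|(z i).2 - y.2|.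
    by apply: contrapT => /not_orP[/negP + /negP]; rewrite -!ltNge => ? ?;
      exact: nA.
  by case; rewrite ler_normr => /orP[] h;
    [apply: (key (1, 0))|apply: (key (-1, 0))
    |apply: (key (0, 1))|apply: (key (0, -1))];
    rewrite ?inE ?eqxx ?orbT// /dot /=; lra.
have sum_bad : \sum_(u <- dirs) bad u <= (C l)^-1 / 2 * expR (N * Lam l).
  apply: (@le_trans _ _ (D / N * expR (N * Lam l))).
    by rewrite /D !mulr_suml; apply: ler_sum => u _.
  rewrite ler_pM2r ?expR_gt0// ler_pdivrMr// -mulrA.
  by rewrite ler_pdivlMl// ler_pdivlMl// mulrA; apply: ltW.
have low : (C l)^-1 / 2 * expR (N * Lam l) <=
    expR (N * (dot l y + (`|l.1| + `|l.2|) * del)) * prob n A.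
  have := mgf_ge n l; rewrite -/N => h; lra.
rewrite -ler_pdivrMl ?expR_gt0// in low; apply: le_trans low.
rewrite -expRN mulrCA -expRD ler_pM2l ?divr_gt0 ?invr_gt0// ler_expR.
by rewrite le_eqVlt (_ : N * _ =
  - (N * (dot l y + (`|l.1| + `|l.2|) * del)) + N * Lam l) ?eqxx//; ring.
Unshelve. all: by end_near. Qed.

Hypothesis Lam_cont : continuous Lam.
Hypothesis Lam_deriv : forall (l u : R * R) (s : R),
  derivable (fun s : R => Lam (l.1 + s * u.1, l.2 + s * u.2)) s 1.
Hypothesis Lam0 : Lam 0 = 0.

(* Adding the quadratic penalty makes the supremum defining the Legendre
   transform attained; the maximiser [l] is then a tilt whose mean [y] is
   close to [x] and costs no more than [x]. *)
Lemma exposed_approx (x : R * R) (b rho : R) :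
  (forall l, dot l x - Lam l <= b) -> 0 < rho ->
  exists y l : R * R, [/\ `|y.1 - x.1| < rho, `|y.2 - x.2| < rho,
    dot l y - Lam l <= b &
    forall del (u : R * R), 0 < del -> exists2 s, 0 < s &
      Lam (l.1 + s * u.1, l.2 + s * u.2) - Lam l - s * dot u y < s * del].
Proof.
move=> xb rho0.
have b0 : 0 <= b by have := xb 0; rewrite Lam0 /dot /= !mul0r addr0 subr0.
(* The maximiser will satisfy [e * |l|^2 <= 2 * b], so [|e * l|^2 <= 2 * e * b], which this [e] puts
   below [rho ^+ 2]. Adding 1 to [b] covers [b = 0]. *)
pose e := rho ^+ 2 / (4 * (b + 1)).
have e0 : 0 < e by rewrite /e divr_gt0 ?exprn_gt0// mulr_gt0//; lra.
have eb : 2 * e * b < rho ^+ 2.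
  rewrite /e (_ : 2 * _ * b = rho ^+ 2 * (b / (2 * (b + 1)))); last by field; lra.
  rewrite gtr_pMr ?exprn_gt0// ltr_pdivrMr; lra.
pose F (l : R * R) := dot l x - Lam l - e / 2 * (l.1 ^+ 2 + l.2 ^+ 2).
(* Outside this box the penalty exceeds [b], so [F] is negative while [F 0 = 0]: a maximiser on the
   box is global. Since [r >= 1], a coordinate of size above [r] has a square above [r] as well. *)
pose r := 2 * b / e + 1.
have be : 0 <= 2 * b / e by apply: divr_ge0; [apply: mulr_ge0|apply: ltW].
have [l lbox lmax] : exists2 l, l \in box r & forall t, t \in box r -> F t <= F l.
  apply: compact_EVT_max; [|exact: box_compact|].
    by exists 0; split; rewrite /= in_itv /= /r; apply/andP; split; lra.
  apply: continuous_subspaceT => t.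
  apply: cvgB; first apply: cvgB; last 2 first.
  - exact: Lam_cont.
  - apply: cvgM; first exact: cvg_cst.
    by rewrite /GRing.exp /=; apply: cvgD; apply: cvgM;
      (exact: cvg_fst || exact: cvg_snd).
  - rewrite /dot; apply: cvgD; apply: cvgM; try exact: cvg_cst.
      exact: cvg_fst.
    exact: cvg_snd.
have F0 : F 0 = 0.
  by rewrite /F Lam0 /dot /= expr0n /= !mul0r !addr0 subr0 mulr0 subr0.
have F0l : 0 <= F l.
  rewrite -F0; apply: lmax; rewrite inE.
  by split; rewrite /= in_itv /= /r; apply/andP; split; lra.
have sqr (t : R) : r < `|t| -> 2 * b / e < t ^+ 2.
  rewrite -real_normK ?num_real// /r => h.
  have : 1 * `|t| <= `|t| * `|t| by apply: ler_wpM2r => //; lra.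
  rewrite expr2; lra.
have {}lmax t : F t <= F l.
  have [tb|tb] := pselect (box r t); first by apply: lmax; rewrite inE.
  apply: le_trans F0l.
  have : r < `|t.1| \/ r < `|t.2|.
    apply: contrapT => /not_orP[/negP + /negP].
    rewrite -!leNgt !ler_norml => h1 h2.
    by apply: tb; split; rewrite /= in_itv.
  have h (p q : R) : r < `|p| -> 2 * b / e < p ^+ 2 + q ^+ 2.
    by move=> /sqr; have := sqr_ge0 q; lra.
  have {h} h : r < `|t.1| \/ r < `|t.2| -> 2 * b < e * (t.1 ^+ 2 + t.2 ^+ 2).
    case=> /h hh; rewrite -ltr_pdivrMl// [_^-1 * _]mulrC; first exact: hh.
    by rewrite [_ + t.2 ^+ 2]addrC; exact: hh.
  by move=> /h; have := xb t; rewrite /F; lra.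
have le2 : e * (l.1 ^+ 2 + l.2 ^+ 2) <= 2 * b.
  by have := xb l; move: F0l; rewrite /F; lra.
have le_rho (t q : R) : e * (t ^+ 2 + q ^+ 2) <= 2 * b -> `|e * t| < rho.
  move=> h.
  rewrite -(ltr_pXn2r (_ : 0 < 2)%N) ?nnegrE ?normr_ge0 ?ltW//.
  rewrite real_normK ?num_real//; apply: le_lt_trans eb.
  rewrite exprMn expr2 -[e * e * _]mulrA -[leRHS]mulrA [leRHS]mulrCA ler_pM2l//.
  have : 0 <= e * q ^+ 2 by rewrite mulr_ge0 ?sqr_ge0// ltW.
  lra.
exists (x.1 - e * l.1, x.2 - e * l.2), l; split => /=.
- rewrite addrAC subrr add0r normrN; exact: le_rho le2.
- rewrite addrAC subrr add0r normrN; rewrite addrC in le2; exact: le_rho le2.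
- apply: le_trans (xb l); rewrite lerB// /dot /= !mulrBr.
  rewrite (_ : _ + _ = l.1 * x.1 + l.2 * x.2 - e * (l.1 ^+ 2 + l.2 ^+ 2));
    last ring.
  rewrite gerBl; apply: mulr_ge0; first exact: ltW.
  by apply: addr_ge0; exact: sqr_ge0.
- move=> del u del0.
  pose q := e / 2 * (u.1 ^+ 2 + u.2 ^+ 2).
  pose k := dot u (x.1 - e * l.1, x.2 - e * l.2).
  (* [psi s] equals [F l] minus [F] at [l] shifted by [s] times [u], hence is minimal at 0. Dropping
     the nonnegative term [q * s ^+ 2] leaves the slope bound. *)
  pose psi s := Lam (l.1 + s * u.1, l.2 + s * u.2) - Lam l - s * k + q * s ^+ 2.
  have [||||s s0 hs] := @slope_at_min _ psi del.
  + move=> s; apply: derivableD; last first.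
      by apply: derivableM => //; apply: derivableX.
    apply: derivableB; last by apply: derivableM.
    by apply: derivableB => //; exact: Lam_deriv.
  + rewrite /psi !mul0r !addr0 -surjective_pairing subrr expr0n /=.
    by rewrite mulr0 subr0 addr0.
  + move=> s; have := lmax (l.1 + s * u.1, l.2 + s * u.2).
    by rewrite /F /psi /q /k /dot /=; lra.
  + exact: del0.
  exists s => //; apply: le_lt_trans hs.
  rewrite /psi lerDl; apply: mulr_ge0; last exact: sqr_ge0.
  apply: mulr_ge0; last by apply: addr_ge0; exact: sqr_ge0.
  by apply: divr_ge0 => //; exact: ltW.
Qed.

Lemma weighted_prob_sub n (A A' : set (R * R)) :
  A `<=` A' -> prob n A <= prob n A'.
Proof.
move=> AA'; rewrite /prob /weighted_prob big_mkcond [leRHS]big_mkcond /=.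
apply: ler_sum => i _; case: asboolP => [/AA' Ai|_]; first by case: asboolP.
by case: ifP.
Qed.

Lemma weighted_lower_bound (O : set (R * R)) (x : R * R) (b eta : R) :
  open O -> O x -> (legendre Lam x <= b%:E)%E -> 0 < eta ->
  exists2 c : R, 0 < c & \forall n \near \oo,
    c * expR (- (n.+1%:R * (b + eta))) <= prob n O.
Proof.
move=> Oo Ox /legendre_le xb eta0.
have [rho rho0 Orho] : exists2 rho : R, 0 < rho &
    forall p : R * R, `|p.1 - x.1| < rho -> `|p.2 - x.2| < rho -> O p.
  have : nbhs x O by exact: open_nbhs_nbhs.
  move=> /nbhs_ballP[rho rho0 h]; exists rho => // p p1 p2.
  by apply: h; split; rewrite /ball /= distrC.
have rho20 : 0 < rho / 2 by lra.
have [y [l [y1 y2 ly sl]]] := exposed_approx xb rho20.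
pose a := `|l.1| + `|l.2| + 1.
have a1 : 1 <= a by rewrite /a lerDr addr_ge0.
(* The first bound keeps the square around [y] inside the [rho]-square around [x], hence in [O]; the
   second makes the tilting cost at most [eta]. The 1 in [a] avoids a zero denominator. *)
pose del := Num.min (rho / 2) (eta / a).
have del0 : 0 < del by rewrite /del lt_min rho20 divr_gt0//; lra.
have [c c0 hc] := weighted_lower_bound_tilt del0 (fun u => sl del u del0).
exists c => //; apply: filterS hc => n; set P := prob n _ => hP.
apply: (@le_trans _ _ P).
  apply: le_trans hP; rewrite ler_pM2l// ler_expR -mulrN ler_pM2l ?ltr0n//.
  have : (`|l.1| + `|l.2|) * del <= eta.
    have le1 : (`|l.1| + `|l.2|) * del <= a * del by rewrite ler_pM2r// /a lerDl.
    apply: (le_trans le1); rewrite -ler_pdivlMl; last lra.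
    by rewrite mulrC /del ge_min lexx orbT.
  by lra.
apply: weighted_prob_sub => p [p1 p2].
have : del <= rho / 2 by rewrite /del ge_min lexx.
move=> dr; apply: Orho.
  rewrite (_ : _ - _ = (p.1 - y.1) + (y.1 - x.1)); last ring.
  by apply: (le_lt_trans (ler_normD _ _)); lra.
rewrite (_ : _ - _ = (p.2 - y.2) + (y.2 - x.2)); last ring.
by apply: (le_lt_trans (ler_normD _ _)); lra.
Qed.

End GartnerEllis.

(** * Passage to the logarithmic scale and the abstract large deviation principle *)

Lemma scaled_lne_le (R : realType) (p D c e : R) (N : R) :
  0 < N -> 0 < D -> ln D <= N * e -> p <= D * expR (- (N * c)) ->
  ((N^-1)%:E * lne p%:E <= (- c + e)%:E)%E.
Proof.
move=> N0 D0 DN pD; have [p0|p0] := leP p 0.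
  by rewrite le0_lneNy ?lee_fin// gt0_muleNy ?leNye// lte_fin invr_gt0.
rewrite lne_EFin// -EFinM lee_fin ler_pdivrMl//.
have : ln p <= ln (D * expR (- (N * c))).
  by rewrite ler_ln ?posrE// mulr_gt0// expR_gt0.
by rewrite lnM ?posrE ?expR_gt0// expRK; lra.
Qed.

Lemma scaled_lne_ge (R : realType) (p D c e : R) (N : R) :
  0 < N -> 0 < D -> - ln D <= N * e -> D * expR (- (N * c)) <= p ->
  ((- c - e)%:E <= (N^-1)%:E * lne p%:E)%E.
Proof.
move=> N0 D0 DN Dp.
have q0 : 0 < D * expR (- (N * c)) by rewrite mulr_gt0// expR_gt0.
have p0 : 0 < p by exact: lt_le_trans Dp.
rewrite lne_EFin// -EFinM lee_fin ler_pdivlMl//.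
have : ln (D * expR (- (N * c))) <= ln p by rewrite ler_ln ?posrE.
by rewrite lnM ?posrE ?expR_gt0// expRK; lra.
Qed.

Lemma near_le_natmul (R : realType) (x e : R) :
  0 < e -> \forall n \near \oo, x <= n.+1%:R * e.
Proof.
move=> e0; near=> n; rewrite -ler_pdivrMr//.
apply: (@le_trans _ _ n%:R); last by rewrite ler_nat.
by near: n; exact: nbhs_infty_ger.
Unshelve. all: by end_near. Qed.

Lemma natS_speed (R : realType) : speed (fun n => n.+1%:R : R).
Proof.
split=> [n|]; first by rewrite ltr0n.
apply/cvgryPge => x; near=> n.
apply: (@le_trans _ _ n%:R); last by rewrite ler_nat.
by near: n; exact: nbhs_infty_ger.
Unshelve. all: by end_near. Qed.

(** Index [n] stands for time [n.+1], which keeps the speed positive. *)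
Theorem weighted_LDP (R : realType) (d : measure_display)
    (T : measurableType d) (P : probability T R) (Zn : nat -> T -> R * R)
    (I : nat -> finType) (w : forall n, I n -> R)
    (z : forall n, I n -> R * R) (Lam : R * R -> R) (C : R * R -> R) (B : R)
    (w_ge0 : forall n i, 0 <= w n i)
    (z_box : forall n i, box B (z n i))
    (C_gt0 : forall l, 0 < C l)
    (mgf_le : forall n l, \sum_i w n i * expR (n.+1%:R * dot l (z n i)) <=
       C l * expR (n.+1%:R * Lam l))
    (mgf_ge : forall n l, (C l)^-1 * expR (n.+1%:R * Lam l) <=
       \sum_i w n i * expR (n.+1%:R * dot l (z n i)))
    (Lam_cont : continuous Lam)
    (Lam_deriv : forall (l u : R * R) (s : R),
       derivable (fun s : R => Lam (l.1 + s * u.1, l.2 + s * u.2)) s 1)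
    (Lam0 : Lam 0 = 0)
    (Zn_meas : forall n A, measurable (Zn n @^-1` A))
    (Zn_law : forall n A, P (Zn n @^-1` A) = (weighted_prob (w n) (z n) A)%:E) :
  satisfies_LDP P Zn (fun n => n.+1%:R) (legendre Lam).
Proof.
have [[L0 Llsc] _] := legendre_good Lam0.
split=> //; first exact: natS_speed.
- move=> O Oo; apply: lee_fin_lt => r.
  rewrite lteNr => /ereal_inf_lt[_ [x Ox <-]].
  have := L0 x; case E : (legendre Lam x) => [b| |] // _.
  rewrite -EFinN lte_fin => br.
  (* Half of the gap between [b] and [- r] is spent in the exponent, the other half on [- ln c],
     which is eventually small relative to [n.+1]. *)
  have eta0 : 0 < (- r - b) / 2 by lra.
  have Lb : (legendre Lam x <= b%:E)%E by rewrite E.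
  have [c c0 hc] := weighted_lower_bound w_ge0 C_gt0 mgf_le mgf_ge Lam_cont
    Lam_deriv Lam0 Oo Ox Lb eta0.
  apply: limn_einf_ge_near.
  have := near_le_natmul (- ln c) eta0.
  apply: filterS2 hc => n cP cn; rewrite Zn_law.
  have := scaled_lne_ge (ltr0Sn _ n) c0 cn cP.
  by apply: le_trans; rewrite lee_fin; lra.
- move=> K Kc; rewrite leeNr; apply: lee_fin_lt => r rK.
  rewrite leeNr.
  have rL x : K x -> (r%:E < legendre Lam x)%E.
    by move=> Kx; apply: (lt_le_trans rK); apply: ereal_inf_lbound; exists x.
  have [D hD] := weighted_upper_bound w_ge0 z_box mgf_le Kc rL.
  (* The constant [D] carries no sign information, so it is raised to at least 1 before its
     logarithm is taken. *)
  have D1 : 0 < Num.max D 1 by rewrite lt_max ltr01 orbT.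
  apply/lee_addgt0Pr => e e0; apply: limn_esup_le_near.
  apply: filterS (near_le_natmul (ln (Num.max D 1)) e0) => n hn.
  rewrite Zn_law -EFinN -EFinD; apply: (scaled_lne_le (ltr0Sn _ n) D1 hn).
  apply: le_trans (hD n) _; rewrite ler_pM2r ?expR_gt0//.
  by rewrite le_max lexx.
Qed.

(** * Steps and paths of the hexagonal walk *)

Section HexagonalSteps.
Variables (R : realType) (a : R) (q : 'I_2 -> 'I_3 -> R).

(** Both expressions for the cosine of [2 * pi / 3] give [2 * c ^+ 2 - 1 = - c], whose only positive
    root is [1 / 2]. *)
Lemma cos_pi_third : cos (pi / 3) = 1 / 2 :> R.
Proof.
have p0 := pi_gt0 R.
set c : R := cos (pi / 3).
have c0 : 0 < c by apply: cos_gt0_pihalf; apply/andP; split; lra.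
have h1 : cos (pi / 3 *+ 2) = c ^+ 2 *+ 2 - 1 by rewrite cos_mulr2n.
have h2 : cos (pi / 3 *+ 2) = - c :> R.
  rewrite -[LHS]opprK -cosDpi /c -[in RHS]cosN -(cosD2pi (- (pi / 3))).
  by congr (- cos _); field.
have : (c - 1 / 2) * (c + 1) = 0 by rewrite h2 in h1; lra.
by move/eqP; rewrite mulf_eq0 => /orP[] /eqP; lra.
Qed.

Lemma sin_pi_third : sin (pi / 3) = Num.sqrt 3 / 2 :> R.
Proof.
have p0 := pi_gt0 R.
have s0 : 0 < sin (pi / 3) :> R by apply: sin_gt0_pi; apply/andP; split; lra.
have : sin (pi / 3) ^+ 2 = (Num.sqrt 3 / 2) ^+ 2 :> R.
  by rewrite sin2cos2 cos_pi_third [in RHS]expr_div_n sqr_sqrtr//; lra.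
move/eqP; rewrite eqf_sqr => /orP[/eqP//|/eqP h].
by have : 0 <= Num.sqrt 3 :> R by []; lra.
Qed.

Lemma hex_cos (i : 'I_2) (r : 'I_3) :
  cos (2 * pi * r%:R / 3 + i%:R * pi) =
  (-1) ^+ i * (if r == 0%N :> nat then 1 else - (1 / 2)) :> R.
Proof.
have -> : cos (2 * pi * r%:R / 3 + i%:R * pi) =
    (-1) ^+ i * cos (2 * pi * r%:R / 3) :> R.
  case: i => [[|[|//]] ?] /=; first by rewrite mul0r addr0 expr0 mul1r.
  by rewrite mul1r cosDpi expr1 mulN1r.
congr (_ * _); case: r => [[|[|[|//]]] ?] /=.
- by rewrite mulr0 mul0r cos0.
- rewrite (_ : _ / 3 = pi / 3 *+ 2); last by field.
  by rewrite cos_mulr2n cos_pi_third; field.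
- rewrite (_ : _ / 3 = pi / 3 + pi); last by field.
  by rewrite cosDpi cos_pi_third.
Qed.

Lemma hex_sin (i : 'I_2) (r : 'I_3) :
  sin (2 * pi * r%:R / 3 + i%:R * pi) =
  (-1) ^+ i * (if r == 0%N :> nat then 0 else
               if r == 1%N :> nat then Num.sqrt 3 / 2
               else - (Num.sqrt 3 / 2)) :> R.
Proof.
have -> : sin (2 * pi * r%:R / 3 + i%:R * pi) =
    (-1) ^+ i * sin (2 * pi * r%:R / 3) :> R.
  case: i => [[|[|//]] ?] /=; first by rewrite mul0r addr0 expr0 mul1r.
  by rewrite mul1r sinDpi expr1 mulN1r.
congr (_ * _); case: r => [[|[|[|//]]] ?] /=.
- by rewrite mulr0 mul0r sin0.
- rewrite (_ : _ / 3 = pi / 3 *+ 2); last by field.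
  by rewrite sin_mulr2n cos_pi_third sin_pi_third; field.
- rewrite (_ : _ / 3 = pi / 3 + pi); last by field.
  by rewrite sinDpi sin_pi_third.
Qed.

Definition hex_step (i : 'I_2) (r : 'I_3) : R * R := hex_move a i r 0.

Lemma hex_moveE i r (z : R * R) : hex_move a i r z = z + hex_step i r.
Proof. by rewrite /hex_step /hex_move /= !add0r. Qed.

Lemma hex_stepE i r : hex_step i r =
  (a * ((-1) ^+ i * (if r == 0%N :> nat then 1 else - (1 / 2))),
   a * ((-1) ^+ i * (if r == 0%N :> nat then 0 else
               if r == 1%N :> nat then Num.sqrt 3 / 2
               else - (Num.sqrt 3 / 2)))).
Proof. by rewrite /hex_step /hex_move /= hex_cos hex_sin !add0r. Qed.

Definition step_mgf (i : 'I_2) (l : R * R) : R :=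
  \sum_(r < 3) q i r * expR (dot l (hex_step i r)).

Lemma sum_ord3 (f : 'I_3 -> R) : \sum_(r < 3) f r = f 0 + f 1 + f 2.
Proof.
rewrite !big_ord_recl big_ord0 addr0 addrA.
by congr (f _ + f _ + f _); apply/val_inj.
Qed.

(** Factoring out the horizontal step [r = 0] leaves [hex_g]. The factors extracted on the two sides
    are inverse to each other, so they cancel in [hex_LambdaE]. *)
Lemma step_mgfE i l :
  step_mgf i l = expR ((-1) ^+ i * a * l.1) * hex_g a q i l.
Proof.
rewrite /step_mgf sum_ord3 /hex_g !mulrDr; congr (_ + _ + _).
- rewrite mulrC hex_stepE /dot /=; congr (expR _ * _); ring.
- rewrite mulrCA -expRD hex_stepE /dot /=; congr (_ * expR _).
  have h : Num.sqrt 3 ^+ 2 = 3 :> R by rewrite sqr_sqrtr.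
  by field: h.
- rewrite mulrCA -expRD hex_stepE /dot /=; congr (_ * expR _).
  have h : Num.sqrt 3 ^+ 2 = 3 :> R by rewrite sqr_sqrtr.
  rewrite exprS. by field: h.
Qed.

Lemma hex_LambdaE l :
  hex_Lambda a q l = 1 / 2 * ln (step_mgf 0 l * step_mgf 1 l).
Proof.
rewrite /hex_Lambda !step_mgfE /= expr0 expr1 mulrACA -expRD.
by rewrite mulN1r !mul1r mulNr subrr expR0 mul1r.
Qed.

Hypothesis q_ge0 : forall i r, 0 <= q i r.
Hypothesis q_sum1 : forall i, \sum_(r < 3) q i r = 1.

(** If the sum vanished, so would every [q i r], against their sum being 1. Positivity is what makes
    [ln] continuous and differentiable here. *)
Lemma step_mgf_gt0 i l : 0 < step_mgf i l.
Proof.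
have h r : 0 <= q i r * expR (dot l (hex_step i r)) by rewrite mulr_ge0 ?expR_ge0.
rewrite lt0r sumr_ge0 // andbT psumr_neq0// -[has _ _]negbK -all_predC.
apply/negP => /allP h0; have := q_sum1 i; rewrite big1.
  by move/eqP; rewrite eq_sym oner_eq0.
move=> r _; have := h0 r (mem_index_enum r); rewrite /= -leNgt => hr.
have /eqP : q i r * expR (dot l (hex_step i r)) = 0.
  by apply/eqP; rewrite eq_le hr h.
by rewrite mulf_eq0 [expR _ == 0]gt_eqF ?expR_gt0// orbF => /eqP.
Qed.

Lemma hex_Lambda0 : hex_Lambda a q 0 = 0.
Proof.
have h i : step_mgf i 0 = 1.
  rewrite -[RHS](q_sum1 i); apply: eq_bigr => r _.
  by rewrite /dot !mul0r addr0 expR0 mulr1.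
by rewrite hex_LambdaE !h mulr1 ln1 mulr0.
Qed.

Lemma step_mgf_continuous i : continuous (step_mgf i).
Proof.
move=> l.
have -> : step_mgf i = (fun l => q i 0 * expR (dot l (hex_step i 0))
   + q i 1 * expR (dot l (hex_step i 1)) + q i 2 * expR (dot l (hex_step i 2))).
  by apply/funext => l'; rewrite /step_mgf sum_ord3.
have h r : q i r * expR (dot l' (hex_step i r)) @[l' --> l] -->
    q i r * expR (dot l (hex_step i r)).
  apply: cvgM; first exact: cvg_cst.
  apply: (@continuous_comp _ _ _ (fun l => dot l (hex_step i r)) expR);
    last exact: continuous_expR.
  by apply: cvgD; apply: cvgM;
    (exact: cvg_cst || exact: cvg_fst || exact: cvg_snd).
by apply: cvgD; first apply: cvgD.
Qed.

Lemma hex_Lambda_continuous : continuous (hex_Lambda a q).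
Proof.
move=> l.
have -> : hex_Lambda a q = (fun l => 1 / 2 * ln (step_mgf 0 l * step_mgf 1 l)).
  by apply/funext => l'; rewrite hex_LambdaE.
apply: cvgM; first exact: cvg_cst.
apply: (@continuous_comp _ _ _ (fun l => step_mgf 0 l * step_mgf 1 l) (@ln R)).
  by apply: cvgM; exact: step_mgf_continuous.
by apply: continuous_ln; rewrite mulr_gt0 ?step_mgf_gt0.
Qed.

Lemma step_mgf_derivable i (l u : R * R) (s : R) :
  derivable (fun s : R => step_mgf i (l.1 + s * u.1, l.2 + s * u.2)) s 1.
Proof.
have h (r : 'I_3) : derivable
    (fun s : R =>
       q i r * expR (dot (l.1 + s * u.1, l.2 + s * u.2) (hex_step i r))) s 1.
  by apply: derivableM.
have -> : (fun s : R => step_mgf i (l.1 + s * u.1, l.2 + s * u.2)) = (fun s =>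
    q i 0 * expR (dot (l.1 + s * u.1, l.2 + s * u.2) (hex_step i 0))
  + q i 1 * expR (dot (l.1 + s * u.1, l.2 + s * u.2) (hex_step i 1))
  + q i 2 * expR (dot (l.1 + s * u.1, l.2 + s * u.2) (hex_step i 2))).
  by apply/funext => t; rewrite /step_mgf sum_ord3.
by apply: derivableD => //; apply: derivableD.
Qed.

Lemma hex_Lambda_derivable (l u : R * R) (s : R) :
  derivable (fun s : R => hex_Lambda a q (l.1 + s * u.1, l.2 + s * u.2)) s 1.
Proof.
have -> : (fun s : R => hex_Lambda a q (l.1 + s * u.1, l.2 + s * u.2)) =
    (fun s => 1 / 2 * (@ln R \o (fun s =>
      step_mgf 0 (l.1 + s * u.1, l.2 + s * u.2) *
      step_mgf 1 (l.1 + s * u.1, l.2 + s * u.2))) s).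
  by apply/funext => t; rewrite hex_LambdaE.
apply: derivableM => //.
apply: ex_derive; apply: is_derive1_comp.
  by apply: is_derive1_ln; rewrite mulr_gt0 ?step_mgf_gt0.
by apply: derivableP; apply: derivableM; exact: step_mgf_derivable.
Qed.

End HexagonalSteps.

(** * Positions along a sequence of directions *)

Section HexagonalPaths.
Variables (R : realType) (a : R) (q : 'I_2 -> 'I_3 -> R).
Hypothesis a_gt0 : 0 < a.

(** The walk starts in [hex_vertices 0] and changes side at every step, so the side at time [k] is
    the parity of [k]. *)
Definition side (k : nat) : 'I_2 := if odd k then 1 else 0.

Fixpoint path_pos (w : nat -> 'I_3) (k : nat) : R * R :=
  if k is k'.+1 then path_pos w k' + hex_step a (side k') (w k') else 0.

Lemma hex_step_inj i : injective (hex_step a i).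
Proof.
move=> r r'; rewrite !hex_stepE => -[].
have a0 : a != 0 by rewrite gt_eqF.
have s0 : (-1) ^+ i != 0 :> R by rewrite signr_eq0.
move=> /(mulfI a0)/(mulfI s0) h1 /(mulfI a0)/(mulfI s0) h2.
have t0 : 0 < Num.sqrt 3 :> R by rewrite sqrtr_gt0.
apply: val_inj; move: h1 h2.
by case: r => [[|[|[|//]]] ?]; case: r' => [[|[|[|//]]] ?] //= h1 h2;
  exfalso; lra.
Qed.

(** Twice the first coordinate divided by [a] is [3 * j + 2 * i], whose residue modulo 3 determines
    [i]. *)
Lemma hex_vertices_inj (z : R * R) (i i' : 'I_2) :
  hex_vertices a i z -> hex_vertices a i' z -> i = i'.
Proof.
move=> [j [k ->]] [j' [k' []]] /= + _ => h.
have : a * ((3 * (j - j'))%:~R - (2 * (i'%:Z - i%:Z))%:~R) = 0.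
  by rewrite !intrM !intrB /=; lra.
move/eqP; rewrite mulf_eq0 gt_eqF//= subr_eq0 eqr_int => /eqP h3.
by apply: val_inj => /=; have := ltn_ord i; have := ltn_ord i'; lia.
Qed.

Lemma hex_verticesI (i : 'I_2) (j k : int) (z : R * R) :
  z.1 = 3 / 2 * a * j%:~R + i%:R * a ->
  z.2 = Num.sqrt 3 / 2 * a * j%:~R + Num.sqrt 3 * a * k%:~R ->
  hex_vertices a i z.
Proof. by move=> h1 h2; exists j, k; rewrite -h1 -h2 -surjective_pairing. Qed.

Lemma hex_step_vertices k r (z : R * R) :
  hex_vertices a (side k) z ->
  hex_vertices a (side k.+1) (z + hex_step a (side k) r).
Proof.
have m12 : (1 %% 2)%N = 1%N by [].
rewrite hex_stepE /side /=; case: (odd k) => /= -[j [m ->]];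
  case: r => [[|[|[|//]]] ?]; rewrite /= ?m12 ?expr1 ?expr0.
(* New lattice coordinates after each of the six moves, those from the odd side first; only
   horizontal moves preserve [j]. *)
- by apply: (@hex_verticesI _ j m) => /=; field.
- by apply: (@hex_verticesI _ (j + 1) (m - 1)) => /=; field.
- by apply: (@hex_verticesI _ (j + 1) m) => /=; field.
- by apply: (@hex_verticesI _ j m) => /=; rewrite ?m12; field.
- by apply: (@hex_verticesI _ (j - 1) (m + 1)) => /=; rewrite ?m12; field.
- by apply: (@hex_verticesI _ (j - 1) m) => /=; rewrite ?m12; field.
Qed.

Lemma path_pos_vertices w k : hex_vertices a (side k) (path_pos w k).
Proof.
elim: k => [|k IH]; last exact: hex_step_vertices.
by exists 0, 0; rewrite /= !mulr0 mul0r !addr0.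
Qed.

(** The sides are disjoint and distinct directions reach distinct points, so a single term of the
    double sum survives. *)
Lemma hex_transition_path w k :
  hex_transition a q (path_pos w k) (path_pos w k.+1) = q (side k) (w k).
Proof.
have notin (i : 'I_2) :
    i != side k -> (path_pos w k \in hex_vertices a i) = false.
  apply: contra_neqF; rewrite inE => /hex_vertices_inj; apply.
  exact: path_pos_vertices.
rewrite /hex_transition (bigD1 (side k)) /=; last first.
  by rewrite inE; exact: path_pos_vertices.
rewrite [X in _ + X]big1 ?addr0; last first.
  by move=> i /andP[+ /notin]; move=> ->.
rewrite (big_pred1 (w k))// => r.
rewrite hex_moveE /= eq_sym (inj_eq (addrI _)).
by rewrite (inj_eq (@hex_step_inj _)).
Qed.

Lemma dotDr (l z z' : R * R) : dot l (z + z') = dot l z + dot l z'.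
Proof. by rewrite /dot /=; ring. Qed.

Lemma dot_path_pos l w n :
  dot l (path_pos w n) = \sum_(k < n) dot l (hex_step a (side k) (w k)).
Proof.
elim: n => [|n IH]; first by rewrite big_ord0 /dot /= !mulr0 addr0.
by rewrite big_ord_recr /= dotDr IH.
Qed.

Lemma path_pos_box w n : box (n%:R * a) (path_pos w n).
Proof.
have st i r : box a (hex_step a i r).
  have h (c : R) : -1 <= c -> c <= 1 -> - a <= a * c <= a.
    by move=> c1 c2; rewrite -mulrN1 ler_pM2l// c1 /= ger_pMr.
  rewrite /hex_step /hex_move /= !add0r.
  by split; rewrite /= in_itv /=; apply: h;
    rewrite ?cos_geN1 ?cos_le1 ?sin_geN1 ?sin_le1.
elim: n => [|n [h1 h2]]; first by split; rewrite /= in_itv /= mul0r oppr0 lexx.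
have [h3 h4] := st (side n) (w n).
move: h1 h2 h3 h4; rewrite /= !in_itv /=.
move=> /andP[? ?] /andP[? ?] /andP[? ?] /andP[? ?].
by split; rewrite /= in_itv /= -natr1 mulrDl mul1r opprD !lerD.
Qed.

End HexagonalPaths.

(** Padding by direction 0 is harmless: the position at time [n] reads only the first [n]
    directions. *)
Definition extend_path n (f : {ffun 'I_n -> 'I_3}) (k : nat) : 'I_3 :=
  if insub k is Some i then f i else 0.

Lemma extend_path_ord n (f : {ffun 'I_n -> 'I_3}) (i : 'I_n) :
  extend_path f i = f i.
Proof. by rewrite /extend_path valK. Qed.

(** * Path weights and their moment generating function *)

Section HexagonalLaw.
Variables (R : realType) (a : R) (q : 'I_2 -> 'I_3 -> R).
Hypothesis a_gt0 : 0 < a.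
Hypothesis q_ge0 : forall i r, 0 <= q i r.
Hypothesis q_sum1 : forall i, \sum_(r < 3) q i r = 1.

Definition path_weight n (f : {ffun 'I_n -> 'I_3}) : R :=
  \prod_(k < n) q (side k) (f k).

Lemma path_weight_ge0 n (f : {ffun 'I_n -> 'I_3}) : 0 <= path_weight f.
Proof. by apply: prodr_ge0 => k _. Qed.

Lemma path_weight_sum n : \sum_(f : {ffun 'I_n -> 'I_3}) path_weight f = 1.
Proof.
rewrite /path_weight -(bigA_distr_bigA (fun (k : 'I_n) r => q (side k) r)).
by apply: big1 => k _; exact: q_sum1.
Qed.

(** The displacement is a sum over steps, so distributivity turns the product of one-step sums into
    a sum over paths. *)
Lemma path_mgf n l :
  \sum_(f : {ffun 'I_n -> 'I_3})
    path_weight f * expR (dot l (path_pos a (extend_path f) n)) =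
  \prod_(k < n) step_mgf a q (side k) l.
Proof.
rewrite /step_mgf (bigA_distr_bigA (fun (k : 'I_n) r =>
  q (side k) r * expR (dot l (hex_step a (side k) r)))).
apply: eq_bigr => f _; rewrite big_split /=; congr (_ * _).
rewrite dot_path_pos expR_sum; apply: eq_bigr => k _.
by rewrite extend_path_ord.
Qed.

(** Two consecutive steps contribute exactly [e ^+ 2]; at odd [n] one factor from side 0 stays
    unpaired. *)
Lemma prod_step_mgf n l (e := expR (hex_Lambda a q l)) :
  \prod_(k < n) step_mgf a q (side k) l =
  (if odd n then step_mgf a q 0 l / e else 1) * e ^+ n.
Proof.
have e2 : e ^+ 2 = step_mgf a q 0 l * step_mgf a q 1 l.
  rewrite /e hex_LambdaE// -expRM_natl mul1r mulrA mulfV// mul1r.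
  by rewrite lnK// posrE mulr_gt0// step_mgf_gt0.
have e0 : e != 0 by rewrite gt_eqF// expR_gt0.
elim: n => [|n IH]; first by rewrite big_ord0 mul1r expr0.
rewrite big_ord_recr /= IH exprS /side; case: (odd n) => /=.
  rewrite mul1r mulrAC [_ / e * _]mulrAC -e2 expr2 mulfK//.
by rewrite mul1r mulrC mulrA divfK.
Qed.

Lemma path_mgf_bounds (l : R * R) : exists C : R, 0 < C /\
  forall n, C^-1 * expR (n%:R * hex_Lambda a q l) <=
     \sum_(f : {ffun 'I_n -> 'I_3})
        path_weight f * expR (dot l (path_pos a (extend_path f) n)) <=
     C * expR (n%:R * hex_Lambda a q l).
Proof.
set e := expR (hex_Lambda a q l).
have e0 : 0 < e by exact: expR_gt0.
have p0 : 0 < step_mgf a q 0 l by exact: step_mgf_gt0.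
pose x := step_mgf a q 0 l / e.
have x0 : 0 < x by rewrite divr_gt0.
have xV0 : 0 < x^-1 by rewrite invr_gt0.
(* This constant dominates 1 and [x], and its inverse lies below both, which settles the two
   parities at once. *)
exists (1 + x + x^-1); split=> [|n]; first lra.
have C0 : 0 < 1 + x + x^-1 by lra.
rewrite path_mgf prod_step_mgf -/e -/x expRM_natl -/e !ler_pM2r ?exprn_gt0//.
case: (odd n); last by rewrite invf_le1//; apply/andP; split; lra.
apply/andP; split; last lra.
by rewrite -[leRHS]invrK lef_pV2 ?posrE//; lra.
Qed.

End HexagonalLaw.

(** * The law of the walk *)

Lemma measure_fin_bigcup_finType (R : realType) (d : measure_display)
    (T : measurableType d) (P : probability T R) (I : finType) (D : pred I)
    (F : I -> set T) :
  trivIset setT F -> (forall i, measurable (F i)) ->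
  P (\bigcup_(i in [set i | D i]) F i) = (\sum_(i | D i) P (F i))%E.
Proof.
move=> tF mF.
rewrite measure_fin_bigcup//; first last.
- exact: sub_trivIset tF.
- exact: finite_finset.
by rewrite (@bigfs _ _ _ _ (index_enum I) D) ?index_enum_uniq// => i _;
  rewrite mem_index_enum.
Qed.

(* Both [P A] and [P (~` A)] are bounded below by the masses of the atoms they
   contain; these masses add up to 1, so both bounds are equalities. *)
Lemma law_of_atoms (R : realType) (d : measure_display)
    (T : measurableType d) (P : probability T R) (U : Type) (Z : T -> U)
    (I : finType) (F : I -> set T) (w : I -> R) (z : I -> U) (A : set U) :
  trivIset setT F -> (forall i, measurable (F i)) ->
  (forall i, P (F i) = (w i)%:E) -> \sum_i w i = 1 ->
  (forall i t, F i t -> Z t = z i) -> measurable (Z @^-1` A) ->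
  P (Z @^-1` A) = (\sum_(i | `[< A (z i) >]) w i)%:E.
Proof.
move=> tF mF PF w1 FZ mA.
have low (D : pred I) (B : set T) : measurable B ->
    (forall i, D i -> F i `<=` B) -> ((\sum_(i | D i) w i)%:E <= P B)%E.
  move=> mB DB; rewrite -sumEFin.
  under eq_bigr do rewrite -PF.
  rewrite -measure_fin_bigcup_finType//; apply: le_measure; rewrite ?inE//.
    by apply: fin_bigcup_measurable => //; exact: finite_finset.
  by apply: bigcup_sub => i /DB.
have lowA : ((\sum_(i | `[< A (z i) >]) w i)%:E <= P (Z @^-1` A))%E.
  by apply: low => // i /asboolP Ai t /FZ /= ->.
have lowC : ((\sum_(i | ~~ `[< A (z i) >]) w i)%:E <= P (~` (Z @^-1` A)))%E.
  apply: low; first exact: measurableC.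
  by move=> i /asboolPn Ai t /FZ /= ->.
move: lowA lowC; rewrite probability_setC//.
have : (P (Z @^-1` A) \is a fin_num) by exact: fin_num_measure.
case: (P _) => // p _; rewrite -EFinB !lee_fin => h1 h2; congr EFin.
move: w1; rewrite (bigID (fun i => `[< A (z i) >])) /=; lra.
Qed.

Section HexagonalWalk.
Variables (R : realType) (a : R) (q : 'I_2 -> 'I_3 -> R).
Hypothesis a_gt0 : 0 < a.
Hypothesis q_ge0 : forall i r, 0 <= q i r.
Hypothesis q_sum1 : forall i, \sum_(r < 3) q i r = 1.
Variables (d : measure_display) (T : measurableType d) (P : probability T R).
Variables (X Y : nat -> {RV P >-> R}).
Hypothesis walk : markov_chain P (hex_lattice a) (hex_transition a q)
  (fun n t => (X n t, Y n t)).
Hypothesis start : {ae P, forall t, X 0%N t = 0 /\ Y 0%N t = 0}.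

Let Z n t := (X n t, Y n t).

Definition follows (w : nat -> 'I_3) (n : nat) : set T :=
  [set t | forall k, (k <= n)%N -> Z k t = path_pos a w k].

Lemma measurable_walk_point n z : measurable [set t | Z n t = z].
Proof.
have -> : [set t | Z n t = z] = X n @^-1` [set z.1] `&` Y n @^-1` [set z.2].
  apply/seteqP; split=> t; rewrite /Z /=; first by move=> <-.
  by move=> [-> ->]; rewrite -surjective_pairing.
by apply: measurableI; apply: measurable_funPTI; exact: measurable_set1.
Qed.

Lemma followsS w n :
  follows w n.+1 = [set t | Z n.+1 t = path_pos a w n.+1] `&` follows w n.
Proof.
apply/seteqP; split=> t /=.
  by move=> h; split; [exact: h|move=> k kn; apply: h; exact: leqW].
by move=> [h1 h2] k; rewrite leq_eqVlt => /predU1P[->//|]; exact: h2.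
Qed.

Lemma measurable_follows w n : measurable (follows w n).
Proof.
elim: n => [|n IH]; last first.
  by rewrite followsS; apply: measurableI => //; exact: measurable_walk_point.
rewrite (_ : follows w 0 = [set t | Z 0%N t = 0]).
  exact: measurable_walk_point.
by apply/seteqP; split=> t /= h; [exact: h|move=> k; rewrite leqn0 => /eqP ->].
Qed.

Lemma path_pos_lattice w k : hex_lattice a (path_pos a w k).
Proof.
have := path_pos_vertices a w k.
by rewrite /side; case: (odd k) => h; [right|left].
Qed.

(** Induction on time: the Markov property multiplies the probability of the past by one transition
    probability. *)
Lemma follows_prob w n :
  P (follows w n) = (\prod_(k < n) q (side k) (w k))%:E.
Proof.
elim: n => [|n IH].
  have mC := measurableC (measurable_follows w 0).
  have : P (~` follows w 0) = 0%E.
    apply: measure_negligible => //; apply: negligibleS start => t /= h.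
    move=> [X0 Y0]; apply: h => k; rewrite leqn0 => /eqP ->.
    by rewrite /Z X0 Y0.
  rewrite probability_setC; last exact: measurable_follows.
  have : P (follows w 0) \is a fin_num.
    by exact: fin_num_measure (measurable_follows w 0).
  rewrite big_ord0; case: (P _) => // p _; rewrite -EFinB => -[h].
  by congr EFin; lra.
rewrite followsS big_ord_recr /=; set B := [set t | _].
have mB : measurable B by exact: measurable_walk_point.
have mF := measurable_follows w n.
(* The Markov property is silent about a null past, but then both sides are 0. *)
have [P0|P0] := eqVneq (P (follows w n)) 0%E.
  have [->] : (\prod_(k < n) q (side k) (w k))%:E = 0%:E by rewrite -IH P0.
  rewrite mul0r.
  apply: (@subset_measure0 _ _ _ P _ (follows w n)) => //.
  exact: measurableI.
have [_ /(_ n (path_pos a w))] := walk.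
move=> /(_ (fun k _ => path_pos_lattice w k) P0).
rewrite hex_transition_path// /cond_prob -/(Z _) -/B -/(follows w n).
have : P (B `&` follows w n) \is a fin_num.
  by apply: fin_num_measure; exact: measurableI.
move: P0; rewrite IH eqe; case: (P (B `&` _)) => // p p0 _ /= h.
by congr EFin; rewrite -h [RHS]mulrC divfK.
Qed.

(** Successive positions determine the directions, by injectivity of [hex_step]. *)
Lemma follows_trivIset n :
  trivIset setT (fun f : {ffun 'I_n -> 'I_3} => follows (extend_path f) n).
Proof.
move=> f g _ _ [t [/= tf tg]]; apply/ffunP => i.
have h k : (k <= n)%N ->
    path_pos a (extend_path f) k = path_pos a (extend_path g) k.
  by move=> kn; rewrite -tf// tg.
have := h i.+1 (ltn_ord i); rewrite /= h; last exact: ltnW.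
by move/addrI/(hex_step_inj a_gt0); rewrite !extend_path_ord.
Qed.

(** The walk takes values in a countable lattice, so the preimage of an arbitrary set is a countable
    union of point events. *)
Lemma measurable_walk_preimage n A : measurable (Z n @^-1` A).
Proof.
have [ZL _] := walk.
pose v (p : 'I_2 * (int * int)) : R * R :=
  (3 / 2 * a * p.2.1%:~R + p.1%:R * a,
   Num.sqrt 3 / 2 * a * p.2.1%:~R + Num.sqrt 3 * a * p.2.2%:~R).
have hv t : exists p, Z n t = v p.
  by have [] := ZL n t => -[j [k E]]; [exists (0, (j, k))|exists (1, (j, k))].
rewrite (_ : _ @^-1` _ = \bigcup_p [set t | Z n t = v p /\ A (v p)]).
  apply: countable_bigcupT_measurable => [|p]; first exact: countableP.
  have [Ap|Ap] := pselect (A (v p)).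
    rewrite (_ : [set t | _] = [set t | Z n t = v p]).
      exact: measurable_walk_point.
    by apply/seteqP; split=> t //= [].
  by rewrite (_ : [set t | _] = set0)//; apply/seteqP; split=> t //= [].
apply/seteqP; split=> t /=.
  by move=> At; have [p E] := hv t; exists p => //; split=> //; rewrite -E.
by move=> [p _ [-> ]].
Qed.

Lemma walk_law n A : P (Z n @^-1` A) =
  (\sum_(f : {ffun 'I_n -> 'I_3} | `[< A (path_pos a (extend_path f) n) >])
     path_weight q f)%:E.
Proof.
apply: (@law_of_atoms _ _ _ P _ _ _
  (fun f : {ffun 'I_n -> 'I_3} => follows (extend_path f) n)).
- exact: follows_trivIset.
- by move=> f; exact: measurable_follows.
- move=> f; rewrite follows_prob; congr EFin; apply: eq_bigr => k _.
  by rewrite extend_path_ord.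
- exact: path_weight_sum.
- by move=> f t; apply.
- exact: measurable_walk_preimage.
Qed.

End HexagonalWalk.

Theorem proposition4p1 (R : realType) (a : R) (q : 'I_2 -> 'I_3 -> R)
    (a_gt0 : 0 < a)
    (q_ge0 : forall i r, 0 <= q i r)
    (q_sum1 : forall i, \sum_(r < 3) q i r = 1)
    (d : measure_display) (T : measurableType d) (P : probability T R)
    (X Y : nat -> {RV P >-> R})
    (walk : markov_chain P (hex_lattice a) (hex_transition a q)
              (fun n t => (X n t, Y n t)))
    (start : {ae P, forall t, X 0%N t = 0 /\ Y 0%N t = 0}) :
  good_rate_function (hex_Lambda_star a q) /\
  satisfies_LDP P
    (fun n t => (X n.+1 t / n.+1%:R, Y n.+1 t / n.+1%:R))
    (fun n => n.+1%:R)
    (hex_Lambda_star a q).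
Proof.
have Lam0 := hex_Lambda0 a q_sum1.
(* [hex_Lambda_star a q] is [legendre (hex_Lambda a q)] by unfolding. *)
split; first exact: (legendre_good Lam0).
have [C C_mgf] := choice (path_mgf_bounds a q_ge0 q_sum1).
have N0 n : 0 < n.+1%:R :> R by rewrite ltr0n.
have dotN n (l z : R * R) :
    n.+1%:R * dot l (z.1 / n.+1%:R, z.2 / n.+1%:R) = dot l z.
  by rewrite /dot /=; field; rewrite gt_eqF.
pose w n := @path_weight R q n.+1.
pose z n (f : {ffun 'I_n.+1 -> 'I_3}) : R * R :=
  ((path_pos a (extend_path f) n.+1).1 / n.+1%:R,
   (path_pos a (extend_path f) n.+1).2 / n.+1%:R).
(* The last argument [a] is the box size: each coordinate moves by at most [a] per step. *)
apply: (@weighted_LDP _ _ _ P _ _ w z (hex_Lambda a q) C a) => //.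
- by move=> n f; exact: path_weight_ge0.
- by move=> n f; apply: box_scale => //; exact: path_pos_box.
- by move=> l; have [] := C_mgf l.
- move=> n l; have [_ /(_ n.+1)/andP[_]] := C_mgf l.
  by under eq_bigr do rewrite -(dotN n).
- move=> n l; have [_ /(_ n.+1)/andP[+ _]] := C_mgf l.
  by under eq_bigr do rewrite -(dotN n).
- exact: hex_Lambda_continuous.
- by move=> l u s; exact: hex_Lambda_derivable.
- move=> n A.
  exact: (measurable_walk_preimage walk n.+1
    [set p | A (p.1 / n.+1%:R, p.2 / n.+1%:R)]).
- move=> n A.
  exact: (walk_law a_gt0 q_sum1 walk start n.+1
    [set p | A (p.1 / n.+1%:R, p.2 / n.+1%:R)]).
Qed.
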